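(* For any integers $r,t\ge1$, any real $a\in(3/2,2]$ and any $\gamma>0$, there exists $n_0$ such that for all $n\ge n_0$, every digraph $G$ on $n$ vertices with $e_a(G)\ge a\,t_r(n)+\gamma n^2$ contains $T_{r+1}^t$ as a subdigraph.
   Context: A digraph has no loops and at most one arc in each direction between two vertices. For a digraph $G$, $f_1(G)$ is the number of unordered pairs $\{u,v\}$ such that exactly one of $uv,vu$ is an arc, and $f_2(G)$ is the number of unordered pairs with both $uv$ and $vu$ arcs. For real $a\ge1$, $e_a(G):=a\,f_2(G)+f_1(G)$. $t_r(n)$ is the number of edges of the $r$-partite Turán graph on $n$ vertices (complete $r$-partite graph with parts as equal as possible). $T_{r+1}^t$ is the digraph obtained from the transitive tournament $T_{r+1}$ by replacing each vertex with an independent set of size $t$ and, for each arc $ij$ of $T_{r+1}$, adding all arcs from the $i$-th set to the $j$-th set. *)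

(* Defs.v *)
From HB Require Import structures.
From mathcomp Require Import all_boot all_order all_algebra.
From mathcomp Require Import reals.
Set Implicit Arguments. Unset Strict Implicit. Unset Printing Implicit Defensive.
Import Order.TTheory GRing.Theory Num.Theory.

(* A digraph on vertex set 'I_n is an arc relation [adj : rel 'I_n] with no
   loops; "at most one arc in each direction" is automatic for a relation. *)
Definition loopless (n : nat) (adj : rel 'I_n) : Prop := forall v, ~~ adj v v.

Definition f1 (n : nat) (adj : rel 'I_n) : nat :=
  #|[set p : 'I_n * 'I_n | (p.1 < p.2)%N && (adj p.1 p.2 != adj p.2 p.1)]|.

Definition f2 (n : nat) (adj : rel 'I_n) : nat :=
  #|[set p : 'I_n * 'I_n | (p.1 < p.2)%N && (adj p.1 p.2 && adj p.2 p.1)]|.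

Definition e_a (R : realType) (a : R) (n : nat) (adj : rel 'I_n) : R :=
  a * (f2 adj)%:R + (f1 adj)%:R.

(* t_r(n): number of edges of the r-partite Turan graph on n vertices,
   realized as the complete r-partite graph on {0,..,n-1} whose parts are
   the residue classes mod r (part sizes differ by at most one). *)
Definition turan (r n : nat) : nat :=
  #|[set p : 'I_n * 'I_n | (p.1 < p.2)%N && (p.1 %% r != p.2 %% r)%N]|.

(* G contains T_{r+1}^t as a subdigraph: an injective map of the vertex set
   'I_(r+1) x 'I_t of the blow-up into V(G) such that for every arc i -> j
   of the transitive tournament T_{r+1} (i.e. i < j), every vertex of the
   i-th class sends an arc to every vertex of the j-th class. *)
Definition contains_blowup (n r t : nat) (adj : rel 'I_n) : Prop :=
  exists phi : 'I_r.+1 * 'I_t -> 'I_n,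
    injective phi /\
    forall (i j : 'I_r.+1) (x y : 'I_t), (i < j)%N -> adj (phi (i, x)) (phi (j, y)).

(* Main.v *)
Require Import Defs.
From HB Require Import structures.
From mathcomp Require Import all_boot all_order all_algebra.
From mathcomp Require Import reals.
From mathcomp Require Import ring lra zify.
Import Order.TTheory GRing.Theory Num.Theory.
Local Open Scope ring_scope.

(** Order the vertices of a digraph on [N] vertices at random and keep a vertex
    when all earlier vertices send an arc to it, or when it sends an arc to all
    earlier vertices.  Inserting the kept vertices one by one at the end or at
    the front of a list produces a transitive tournament.  If [v] has [b1]
    vertices (including itself) that do not send it an arc, [b2] to which it
    sends none, and [b] of either kind, it is kept with probability
    [1/b1 + 1/b2 - 1/b >= 3/(2(b1+b2)-b)].  For [a >= 3/2] the total weight at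
    [v] is at most [a (N - (2(b1+b2)-b)/3)], so by convexity a total weight above
    [a (1-1/r) N^2] forces a kept set of more than [r] vertices.  Sampling boundedly
    many vertices turns this into a positive density of transitive
    [(r+1)]-tuples, and the theorem of Erdos on complete [k]-partite
    [k]-uniform hypergraphs finds the blow-up. *)

(** * Averages over independent uniform draws *)

Fixpoint avg (R : realFieldType) (T : finType) (k : nat) (F : seq T -> R) : R :=
  if k is k'.+1 then (\sum_(x : T) avg R T k' (fun s => F (x :: s))) / #|T|%:R
  else F [::].
Arguments avg {R T} k F.

Section Average.
Context {R : realFieldType} {T : finType}.
Implicit Types (F G : seq T -> R) (k m : nat) (s : seq T).

Lemma ler_avg k F G :
  (forall s, size s = k -> F s <= G s) -> avg k F <= avg k G.
Proof.
elim: k F G => [|k IH] F G le_FG /=; first exact: le_FG.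
rewrite ler_wpM2r ?invr_ge0 ?ler0n//; apply: ler_sum => x _.
by apply: IH => s sz; apply: le_FG; rewrite /= sz.
Qed.

Lemma eq_avg k F G :
  (forall s, size s = k -> F s = G s) -> avg k F = avg k G.
Proof.
by move=> eqFG; apply/eqP; rewrite eq_le !ler_avg// => s /eqFG ->.
Qed.

Lemma avgD k F G : avg k (fun s => F s + G s) = avg k F + avg k G.
Proof.
elim: k F G => [|k IH] F G //=.
by rewrite -mulrDl -big_split; congr (_ / _); apply: eq_bigr => x _; rewrite IH.
Qed.

Lemma avgZ k c F : avg k (fun s => c * F s) = c * avg k F.
Proof.
elim: k F => [|k IH] F //=.
by rewrite mulrA mulr_sumr; congr (_ / _); apply: eq_bigr => x _; rewrite IH.
Qed.

Lemma avg_sum (I : finType) k (F : I -> seq T -> R) :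
  avg k (fun s => \sum_i F i s) = \sum_i avg k (F i).
Proof.
elim: k F => [|k IH] F //=.
rewrite -mulr_suml exchange_big; congr (_ / _).
by apply: eq_bigr => x _; rewrite IH.
Qed.

Lemma avg_exchange k m (F : seq T -> seq T -> R) :
  avg k (fun s => avg m (F s)) = avg m (fun u => avg k (F^~ u)).
Proof.
elim: k F => [|k IH] F //=.
under eq_bigr do rewrite IH.
rewrite mulrC -avg_sum -avgZ.
by apply: eq_avg => s _; rewrite mulrC.
Qed.

(** Independent draws may be made in any order. Keeping the drawn entry as a one-entry sequence lets
    [avg_exchange] move it past those before it. *)
Lemma avg_insert m i F : (i <= m)%N ->
  avg m.+1 F = avg 1 (fun x => avg m (fun s => F (take i s ++ x ++ drop i s))).
Proof.
elim: i m F => [|i IH] m F lim.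
  rewrite /=; congr (_ / _); apply: eq_bigr => x _.
  by apply: eq_avg => s _; rewrite take0 drop0.
case: m lim => // m lim.
transitivity (avg 1 (fun y => avg m.+1 (fun s => F (y ++ s)))); first by [].
transitivity (avg 1 (fun y => avg 1 (fun x =>
    avg m (fun s => F (y ++ take i s ++ x ++ drop i s))))).
  by apply: eq_avg => y _; rewrite IH.
rewrite avg_exchange; apply: eq_avg => x _.
by rewrite /=; congr (_ / _); apply: eq_bigr.
Qed.

Lemma nth_insert (x0 x : T) s i j : (i <= size s)%N -> j != i ->
  nth x0 (take i s ++ x :: drop i s) j = nth x0 s (unbump i j).
Proof.
move=> lis ji; rewrite nth_cat size_takel// /unbump.
have [ltji|/=] := ltnP j i; first by rewrite nth_take// ltnNge (ltnW ltji) subn0.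
rewrite leq_eqVlt eq_sym (negbTE ji) /= => ltij.
rewrite ltij -(subnSK ltij) /= nth_drop; congr nth; lia.
Qed.

Lemma mean_cst (c : R) : (0 < #|T|)%N -> (\sum_(x : T) c) / #|T|%:R = c.
Proof.
move=> T0; have nz : #|T|%:R != 0 :> R by rewrite pnatr_eq0 -lt0n.
by rewrite sumr_const -[c *+ _]mulr_natr mulfK.
Qed.

(** Distinct positions of a sample form a uniform sample. The head of [f] is drawn first; deleting
    that position renumbers the others by [unbump], and positions outside [f] average out. *)
Lemma avg_proj (x0 : T) m (f : seq nat) F : uniq f -> all (ltn^~ m) f ->
  (0 < #|T|)%N ->
  avg m (fun s => F [seq nth x0 s j | j <- f]) = avg (size f) F.
Proof.
move=> + + T0; move szf: (size f) => k; elim: k f szf m F => [|k IH] [|i f] //= szf m F.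
  by move=> _ _; elim: m => //= m ->; rewrite mean_cst.
case/andP=> if_ uf; case: m => // m /andP[lim fm].
rewrite (@avg_insert m i) //=; congr (_ / _); apply: eq_bigr => x _.
have unb j : j \in f -> j != i by apply: contraTneq => ->.
rewrite -(IH (map (unbump i) f) _ m); first last.
- apply/allP => _ /mapP[j jf ->]; have := allP fm j jf; have := unb j jf.
  by rewrite /unbump /=; case: (ltngtP i j) => /=; lia.
- rewrite map_inj_in_uniq// => j1 j2 /unb h1 /unb h2.
  by rewrite /unbump; move: h1 h2; case: (ltngtP i j1) (ltngtP i j2) => /= ? [] ?; lia.
- by rewrite size_map; case: szf.
apply: eq_avg => s sz; congr F; congr (_ :: _).
  by rewrite nth_cat size_takel ?sz// ltnn subnn.
rewrite -map_comp; apply/eq_in_map => j /unb ji /=.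
by rewrite nth_insert// sz.
Qed.

Context (T_gt0 : (0 < #|T|)%N).

Lemma avg_cst k c : avg k (fun _ : seq T => c) = c :> R.
Proof.
by elim: k => //= k ->; rewrite mean_cst.
Qed.

Lemma avg_exists k F : exists2 s, size s = k & avg k F <= F s.
Proof.
elim: k F => [|k IH] F; first by exists [::].
suff [x le_x] : exists x, avg k.+1 F <= avg k (fun s => F (x :: s)).
  have [s sz le_s] := IH (fun s => F (x :: s)).
  by exists (x :: s); rewrite /= ?sz// (le_trans le_x).
apply/existsP; rewrite -[X in is_true X]negbK negb_exists; apply/negP => /forallP lt_F.
have: avg k.+1 F < avg k.+1 F.
  rewrite {1}/avg -/avg ltr_pdivrMr ?ltr0n// mulr_natr -sumr_const.
  apply: ltr_sum => [|x _]; last by rewrite ltNge.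
  by have [x _] := card_gt0P T_gt0; apply/hasP; exists x; rewrite ?mem_index_enum.
by rewrite ltxx.
Qed.

Lemma avg_all t (p : pred T) :
  avg t (fun s => (all p s)%:R) = avg 1 (fun s => (all p s)%:R) ^+ t :> R.
Proof.
elim: t => [|t IH] //=; rewrite exprS -IH /= mulrAC.
congr (_ / _); rewrite mulr_suml; apply: eq_bigr => x _; rewrite andbT -avgZ.
by apply: eq_avg => s _; rewrite -natrM mulnb.
Qed.

Lemma avg_mem_le t x :
  avg t (fun s => (x \in s)%:R) <= t%:R / #|T|%:R :> R.
Proof.
elim: t => [|t IH] /=; first by rewrite mul0r.
have le_y y : avg t (fun s => (x \in y :: s)%:R) <= (x == y)%:R + t%:R / #|T|%:R :> R.
  rewrite (le_trans _ (lerD (lexx _) IH))// -[X in X + _](avg_cst t) -avgD.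
  apply: ler_avg => s _; rewrite in_cons.
  by case: eqP; case: (x \in s); rewrite /= ?addr0 ?add0r ?lerDl.
rewrite ler_pM2r ?invr_gt0 ?ltr0n// (le_trans (ler_sum _ (fun y _ => le_y y)))//.
rewrite big_split /= sumr_const -[X in _ + X]mulr_natr divfK ?pnatr_eq0 -?lt0n//.
rewrite -natr_sum -[t.+1]add1n natrD lerD2r ler_nat.
by rewrite (bigD1 x)//= eqxx big1 ?addn0// => y /negbTE; rewrite eq_sym => ->.
Qed.

(** Birthday bound: the head equals one of [t] other entries with probability at most t/|T|, and t +
    t^2 <= (t+1)^2. *)
Lemma avg_nuniq_le t :
  avg t (fun s : seq T => (~~ uniq s)%:R) <= (t ^ 2)%:R / #|T|%:R :> R.
Proof.
elim: t => [|t IH] /=; first by rewrite mul0r.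
rewrite ler_pM2r ?invr_gt0 ?ltr0n//.
have le_x x : avg t (fun s => (~~ uniq (x :: s))%:R) <= (t.+1 ^ 2)%:R / #|T|%:R :> R.
  have := lerD (avg_mem_le t x) IH; rewrite -avgD -mulrDl -natrD => le_t.
  apply: le_trans (le_trans le_t _); last first.
    by rewrite ler_wpM2r ?invr_ge0 ?ler0n// ler_nat; lia.
  apply: ler_avg => s _ /=.
  by case: (x \in s); case: (uniq s); rewrite /= ?addr0 ?add0r ?lerDl ?ler01.
apply: le_trans (ler_sum _ (fun x _ => le_x x)) _.
by rewrite sumr_const -[_ *+ _]mulr_natr divfK ?pnatr_eq0 -?lt0n.
Qed.

End Average.

(** * Transitive tournaments from random vertex orderings *)

Section Transitive.
Context {R : realFieldType} {T : finType} (e : rel T).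

(** The contribution of a pair to [e_a]: 1 for a single arc, [a] for a double one. *)
Definition weight (a : R) (u v : T) : R :=
  (e u v)%:R + (e v u)%:R + (a - 2) * (e u v && e v u)%:R.

Definition nonin (v : T) : {set T} := [set u | ~~ e u v].
Definition nonout (v : T) : {set T} := [set u | ~~ e v u].

(* The probability that, in a uniformly random ordering of [S], either no element
   of [nonin v] precedes [v] or no element of [nonout v] does. *)
Definition early (S : {set T}) (v : T) : R :=
  #|nonin v :&: S|%:R^-1 + #|nonout v :&: S|%:R^-1 - #|(nonin v :|: nonout v) :&: S|%:R^-1.

Context (e_irr : irreflexive e).

(* [1 / #|B :&: S|] is the probability that [v] comes first in [B :&: S];
   condition on the last element [u] of the ordering. *)
Lemma sum_inv_setD1 (S B : {set T}) (v : T) : v \in B -> v \in S ->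
  (B :&: S == [set v])%:R + \sum_(u in S :\ v) #|B :&: (S :\ u)|%:R^-1
  = #|S|%:R / #|B :&: S|%:R :> R.
Proof.
move=> vB vS; have vBS : v \in B :&: S by rewrite inE vB.
have sub : [set v] \subset B :&: S by rewrite sub1set.
rewrite (bigID (mem B)) /=.
rewrite (eq_bigr (fun=> (#|B :&: S|.-1)%:R^-1)); last first.
  move=> u; rewrite !inE => /andP[/andP[uv uS] uB]; congr (_%:R^-1).
  by rewrite setIDA [in RHS](cardsD1 u) !inE uS uB.
rewrite [X in _ + (_ + X)](eq_bigr (fun=> #|B :&: S|%:R^-1)); last first.
  move=> u /andP[_ uB]; congr (#|(_ : {set T})|%:R^-1).
  by apply/setP => x; rewrite !inE; case: eqVneq => //= ->; rewrite (negbTE uB).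
rewrite !sumr_const.
have -> : #|[pred u in S :\ v | u \in B]| = #|B :&: S|.-1.
  by rewrite (cardsD1 v (B :&: S)) vBS; apply: eq_card => u; rewrite !inE andbAC andbA.
have -> : #|[pred u in S :\ v | u \notin B]| = (#|S| - #|B :&: S|)%N.
  rewrite -cardsDS ?subsetIr//; apply: eq_card => u; rewrite !inE.
  case: eqVneq => [->|_]; first by rewrite vB vS.
  by case: (u \in S); rewrite ?andbT ?andbF.
have le_BS : (#|B :&: S| <= #|S|)%N by rewrite subset_leq_card ?subsetIr.
have [] := subset_leqif_cards sub; rewrite cards1 => B_gt0 eq1.
rewrite eq_sym -{}eq1.
case: #|B :&: S| B_gt0 le_BS => // -[|b] _ le_BS /=.
  by rewrite mulr0n add0r invr1 mulr1 -natrD subnKC.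
rewrite -(mulr_natr b.+1%:R^-1) -(mulr_natr b.+2%:R^-1) natrB//.
have b1 : b.+1%:R != 0 :> R by rewrite pnatr_eq0.
have b2 : b.+2%:R != 0 :> R by rewrite pnatr_eq0.
by rewrite mulVf// mulrBr mulVf// add0r addrC subrK mulrC.
Qed.

(** Condition on the last element [u] of the ordering. If [u] differs from [v], deleting it does not
    affect the event for [v]; if [u] is [v], then [v] must be alone in [nonin v :&: S] or in
    [nonout v :&: S]. Inclusion-exclusion combines three uses of [sum_inv_setD1]. *)
Lemma sum_early_setD1 (S : {set T}) (v : T) : v \in S ->
  ((nonin v :&: S == [set v]) || (nonout v :&: S == [set v]))%:R
    + \sum_(u in S :\ v) early (S :\ u) v = #|S|%:R * early S v.
Proof.
move=> vS; have vin : v \in nonin v by rewrite inE e_irr.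
have vout : v \in nonout v by rewrite inE e_irr.
have vU : v \in nonin v :|: nonout v by rewrite inE vin.
rewrite /early big_split big_split /= sumrN mulrBr mulrDr.
rewrite -(sum_inv_setD1 S _ v vin vS) -(sum_inv_setD1 S _ v vout vS).
rewrite -(sum_inv_setD1 S _ v vU vS).
suff -> : ((nonin v :|: nonout v) :&: S == [set v])
   = (nonin v :&: S == [set v]) && (nonout v :&: S == [set v]).
  case: (_ == _); case: (_ == _); rewrite /=; ring.
have eqS (B : {set T}) : v \in B -> (B :&: S == [set v]) = (B :&: S \subset [set v]).
  by move=> vB; rewrite eqEsubset sub1set in_setI vB vS !andbT.
by rewrite !eqS// setIUl subUset.
Qed.

(** The random ordering, derandomised by induction on |S|: a last element [u] doing at least as well
    as average is fixed, and it is kept exactly when [sel u] holds. *)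
Lemma pairwise_ge_early (S : {set T}) : exists s : seq T,
  [/\ {subset s <= S}, pairwise e s & \sum_(v in S) early S v <= (size s)%:R].
Proof.
move cS: #|S| => n; elim: n S cS => [|n IH] S cS.
  exists [::]; split => //; rewrite big_pred0// => v.
  by rewrite (cards0_eq cS) inE.
pose sel v := (nonin v :&: S == [set v]) || (nonout v :&: S == [set v]).
have [u uS le_u] : exists2 u, u \in S &
    \sum_(v in S) early S v <= (sel u)%:R + \sum_(v in S :\ u) early (S :\ u) v.
  (* Summed over [u], the right-hand sides total |S| times the left-hand side, by
     [sum_early_setD1]. *)
  apply/exists_inP; rewrite -[X in is_true X]negbK negb_exists_in.
  apply/negP => /forall_inP lt_u.
  have: \sum_(u in S) ((sel u)%:R + \sum_(v in S :\ u) early (S :\ u) v)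
      < \sum_(u in S) \sum_(v in S) early S v.
    apply: ltr_sum => [|u uS]; last by rewrite ltNge lt_u.
    have [x xS] : exists x, x \in S by apply/card_gt0P; rewrite cS.
    by apply/hasP; exists x; rewrite ?mem_index_enum.
  rewrite sumr_const cS -mulr_natl mulr_sumr.
  rewrite -cS (eq_bigr _ (fun v vS => esym (sum_early_setD1 S v vS))) /=.
  rewrite big_split/= [X in _ < X]big_split /= ltrD2l.
  rewrite (exchange_big_dep (fun v => v \in S)) /=; last first.
    by move=> u v _; rewrite inE => /andP[].
  rewrite [X in _ < X](eq_bigr (fun j =>
    \sum_(i in S | j \in S :\ i) early (S :\ i) j)) ?ltxx//.
  move=> v vS; apply: eq_bigl => x; rewrite !inE vS andbT eq_sym andbC //.
have cSu : #|S :\ u| = n by move: cS; rewrite (cardsD1 u) uS => -[].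
have [s [sS es le_s]] := IH _ cSu.
have sS' : {subset s <= S} by move=> x /sS; rewrite inE => /andP[].
have [|nsel] := boolP (sel u); last first.
  by exists s; split => //; apply: le_trans le_u _; rewrite (negbTE nsel) add0r.
have out (B : {set T}) x : B :&: S == [set u] -> x \in s -> x \notin B.
  move=> /eqP BS xs; apply/negP => xB; have := sS x xs; rewrite !inE => /andP[/negP xu xS].
  by apply: xu; by rewrite -in_set1 -BS inE xB.
have le_su : \sum_(v in S) early S v <= (size s).+1%:R.
  apply: le_trans le_u _; rewrite -natr1 addrC lerD//.
  by case: (sel u); rewrite ?ler01.
case/orP => /out uB.
  exists (rcons s u); rewrite size_rcons pairwise_rcons es andbT; split => //.
    by move=> x; rewrite mem_rcons inE => /predU1P[->|/sS'].
  by apply/allP => x /uB; rewrite inE negbK.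
exists (u :: s); rewrite /= es andbT; split => //.
  by move=> x; rewrite inE => /predU1P[->|/sS'].
by apply/allP => x /uB; rewrite inE negbK.
Qed.

(** With s = b1 + b2, convexity gives 1/b1 + 1/b2 >= 4/s; what remains is (s - b)(2b - s) >= 0, true
    because b1, b2 <= b <= s. *)
Lemma early_setT_ge v :
  3 / (2 * (#|nonin v|%:R + #|nonout v|%:R) - #|nonin v :|: nonout v|%:R)
    <= early setT v.
Proof.
rewrite /early !setIT.
have in_gt0 : 0 < #|nonin v|%:R :> R.
  by rewrite ltr0n; apply/card_gt0P; exists v; rewrite inE e_irr.
have out_gt0 : 0 < #|nonout v|%:R :> R.
  by rewrite ltr0n; apply/card_gt0P; exists v; rewrite inE e_irr.
have le_in : #|nonin v|%:R <= #|nonin v :|: nonout v|%:R :> R.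
  by rewrite ler_nat subset_leq_card ?subsetUl.
have le_out : #|nonout v|%:R <= #|nonin v :|: nonout v|%:R :> R.
  by rewrite ler_nat subset_leq_card ?subsetUr.
have le_U : #|nonin v :|: nonout v|%:R <= #|nonin v|%:R + #|nonout v|%:R :> R.
  by rewrite -natrD ler_nat cardsU leq_subr.
move: in_gt0 out_gt0 le_in le_out le_U.
move: #|nonin v|%:R #|nonout v|%:R #|nonin v :|: nonout v|%:R => b1 b2 b.
move=> b1_gt0 b2_gt0 le1 le2 leD.
have b_gt0 : 0 < b by lra.
have D_gt0 : 0 < 2 * (b1 + b2) - b by lra.
have s_gt0 : 0 < b1 + b2 by lra.
have step1 : 4 / (b1 + b2) <= b1^-1 + b2^-1.
  rewrite -subr_ge0.
  have -> : b1^-1 + b2^-1 - 4 / (b1 + b2) = (b1 - b2) ^+ 2 / (b1 * b2 * (b1 + b2)).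
    by field; rewrite !gt_eqF.
  by rewrite divr_ge0 ?sqr_ge0// !mulr_ge0 ?ltW.
suff : 3 / (2 * (b1 + b2) - b) <= 4 / (b1 + b2) - b^-1 by lra.
rewrite -subr_ge0.
have -> : 4 / (b1 + b2) - b^-1 - 3 / (2 * (b1 + b2) - b)
    = 2 * ((b1 + b2 - b) * (2 * b - (b1 + b2))) / ((b1 + b2) * b * (2 * (b1 + b2) - b)).
  by field; rewrite !gt_eqF.
rewrite divr_ge0 ?mulr_ge0//; lra.
Qed.

(** Each missing direction costs 1 from the full weight [a], and 2 - a is returned once if any
    direction is missing. *)
Lemma sum_weight a v :
  \sum_u weight a u v = a * #|T|%:R - #|nonin v|%:R - #|nonout v|%:R
    + (2 - a) * #|nonin v :|: nonout v|%:R.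
Proof.
have cardE (p : pred T) : #|[set u | p u]|%:R = \sum_u (p u)%:R :> R.
  rewrite -sum1_card natr_sum big_mkcond /=.
  by apply: eq_bigr => u _; rewrite inE; case: (p u).
have -> : #|T|%:R = \sum_(u : T) 1 :> R by rewrite sumr_const.
have -> : nonin v :|: nonout v = [set u | ~~ e u v || ~~ e v u].
  by apply/setP => u; rewrite !inE.
rewrite !cardE !mulr_sumr -!sumrB -big_split; apply: eq_bigr => u _.
rewrite /weight; case: (e u v); case: (e v u) => /=; ring.
Qed.

Lemma weight_le a u v : 1 <= a -> weight a u v <= a.
Proof. by rewrite /weight; case: (e u v); case: (e v u) => /= a1; lra. Qed.

Lemma transitive_of_weight (a : R) (r : nat) : 3 / 2 <= a -> (0 < r)%N ->
  a * (1 - r%:R^-1) * #|T|%:R ^+ 2 < \sum_v \sum_u weight a u v ->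
  exists2 s : seq T, size s = r.+1 & pairwise e s.
Proof.
move=> a_ge r_gt0 lt_w; pose N : R := #|T|%:R.
have r0 : 0 < r%:R :> R by rewrite ltr0n.
have [T0|T_gt0] := posnP #|T|.
  move: lt_w; rewrite T0 expr0n mulr0 big1 ?ltxx// => v.
  by have := fintype0 v; rewrite T0 => /(_ erefl).
have N_gt0 : 0 < N by rewrite ltr0n.
pose D v : R := (2 * (#|nonin v|%:R + #|nonout v|%:R) - #|nonin v :|: nonout v|%:R) / 3.
have D_gt0 v : 0 < D v.
  have : 0 < #|nonin v|%:R :> R.
    by rewrite ltr0n; apply/card_gt0P; exists v; rewrite inE e_irr.
  have : #|nonin v :|: nonout v|%:R <= #|nonin v|%:R + #|nonout v|%:R :> R.
    by rewrite -natrD ler_nat cardsU leq_subr.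
  have : 0 <= #|nonout v|%:R :> R by rewrite ler0n.
  by rewrite /D; lra.
(* The slack is (2a/3 - 1)(2b - b1 - b2); this is where 3/2 <= a enters. *)
have le_D v : \sum_u weight a u v <= a * (N - D v).
  have le_in : #|nonin v|%:R <= #|nonin v :|: nonout v|%:R :> R.
    by rewrite ler_nat subset_leq_card ?subsetUl.
  have le_out : #|nonout v|%:R <= #|nonin v :|: nonout v|%:R :> R.
    by rewrite ler_nat subset_leq_card ?subsetUr.
  rewrite sum_weight -/N /D; move: le_in le_out a_ge.
  move: #|nonin v|%:R #|nonout v|%:R #|nonin v :|: nonout v|%:R => b1 b2 b *.
  nra.
(* Tangent line of [1/x] at [N / r], the largest possible average of [D]. *)
have early_ge v : 2 * (r%:R / N) - (r%:R / N) ^+ 2 * D v <= early setT v.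
  apply: le_trans (early_setT_ge v).
  rewrite [leRHS](_ : _ = (D v)^-1); last by rewrite /D invfM invrK mulrC.
  rewrite -(ler_pM2r (D_gt0 v)) mulVf ?gt_eqF// -subr_ge0.
  suff -> : 1 - (2 * (r%:R / N) - (r%:R / N) ^+ 2 * D v) * D v = (1 - r%:R / N * D v) ^+ 2.
    exact: sqr_ge0.
  ring.
have [s [_ es le_s]] := pairwise_ge_early setT.
have lt_s : r%:R < (size s)%:R :> R.
  apply: lt_le_trans le_s.
  rewrite [ltRHS](eq_bigl predT)//; last by move=> v; rewrite inE.
  apply: lt_le_trans (ler_sum _ (fun v _ => early_ge v)).
  rewrite sumrB -[X in _ - X]mulr_sumr.
  have lt_D : \sum_v D v < N ^+ 2 / r%:R.
    have := lt_le_trans lt_w (ler_sum _ (fun v _ => le_D v)).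
    rewrite -mulr_sumr sumrB sumr_const -mulr_natr -/N -mulrA ltr_pM2l; last by lra.
    by rewrite expr2; lra.
  (* The constant terms add up to 2r, and the terms in [D] take away less than r. *)
  rewrite sumr_const -(mulr_natr (2 * _)) -/N -mulrA divfK ?gt_eqF//.
  have : (r%:R / N) ^+ 2 * \sum_v D v < r%:R.
    have eq_r : (r%:R / N) ^+ 2 * (N ^+ 2 / r%:R) = r%:R by field; rewrite !gt_eqF.
    by rewrite -[ltRHS]eq_r ltr_pM2l// exprn_gt0// divr_gt0.
  lra.
exists (take r.+1 s); last first.
  by move: es; rewrite -{1}(cat_take_drop r.+1 s) pairwise_cat => /and3P[].
by rewrite size_takel// -(ltr_nat R).
Qed.

End Transitive.

(** * Supersaturation by bounded sampling *)

Lemma pairwise_irr_uniq {T : eqType} (e : rel T) (s : seq T) :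
  irreflexive e -> pairwise e s -> uniq s.
Proof.
move=> e_irr; elim: s => //= x s IH /andP[/allP ex /IH ->]; rewrite andbT.
by apply/negP => /ex; rewrite e_irr.
Qed.

(** Average over samples of [m] vertices, with [m] independent of [T]. A sample of weight above
    [kappa] m^2 contains a transitive (r+1)-tuple, and the expected weight is too large for such
    samples to be rare. *)
Lemma supersaturation {R : realType} (a gamma : R) (r : nat) :
  3 / 2 <= a -> (0 < r)%N -> 0 < gamma ->
  exists2 c : R, 0 < c & forall (T : finType) (e : rel T),
    irreflexive e -> (0 < #|T|)%N ->
    (a * (1 - r%:R^-1) + gamma) * #|T|%:R ^+ 2 <= \sum_u \sum_v weight e a u v ->
    c <= avg r.+1 (fun s => (pairwise e s)%:R).
Proof.
move=> a_ge r_gt0 gamma_gt0; pose kappa := a * (1 - r%:R^-1).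
have kappa_ge0 : 0 <= kappa.
  by rewrite mulr_ge0 ?subr_ge0 ?invf_le1 ?ltr0n ?ler1n//; lra.
(* Diagonal positions carry no weight, so only m(m-1) of the m^2 pairs count; this [m] keeps the
   loss below gamma/2 per pair. *)
have [m m_pos m_large] : exists2 m, (0 < m)%N & 2 * (kappa + gamma) < m%:R * gamma.
  exists (Num.trunc (2 * (kappa + gamma) / gamma)).+1 => //.
  by rewrite -ltr_pdivrMr// truncnS_gt.
have m_gt0 : 0 < m%:R :> R by rewrite ltr0n.
have a_gt0 : 0 < a by lra.
exists (gamma / (2 * a * m%:R ^+ r.+1)).
  by rewrite divr_gt0// !mulr_gt0 ?exprn_gt0.
move=> T e e_irr T_gt0 le_w; set p := avg _ _.
have [x0 _] := card_gt0P T_gt0.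
pose W : R := avg 2 (fun s => weight e a (nth x0 s 0) (nth x0 s 1)).
have W_ge : kappa + gamma <= W.
  rewrite /W /= -mulr_suml -mulrA -invfM -expr2 ler_pdivlMr//.
  by rewrite exprn_gt0// ltr0n.
pose S (f : seq T) := \sum_(i < m) \sum_(j < m) weight e a (nth x0 f i) (nth x0 f j).
have avgS : avg m S = m%:R * (m%:R - 1) * W.
  rewrite avg_sum (eq_bigr (fun=> (m%:R - 1) * W)) => [|i _].
    by rewrite sumr_const card_ord -mulrA mulr_natl.
  rewrite avg_sum (bigD1 i)//= (eq_bigr (fun=> W)) => [|j ji].
    rewrite (eq_avg _ _ (fun=> 0)) ?avg_cst// => [|s _].
      rewrite sumr_const cardC1 card_ord add0r -(mulr_natl W); congr (_ * W).
      by rewrite -[in RHS](prednK m_pos) -natr1 addrK.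
    by rewrite /weight e_irr /= mulr0 !addr0.
  apply: (avg_proj x0 m [:: val i; val j]
    (fun s => weight e a (nth x0 s 0) (nth x0 s 1))) => //=.
    by rewrite inE andbT eq_sym.
  by rewrite !ltn_ord.
pose trans (f : seq T) := \sum_(g : r.+1.-tuple 'I_m)
  (uniq g)%:R * (pairwise e [seq nth x0 f j | j <- map val g])%:R : R.
have trans_ge0 f : 0 <= trans f by apply: sumr_ge0 => g _; rewrite mulr_ge0 ?ler0n.
have am_ge0 : 0 <= a * m%:R ^+ 2 by rewrite mulr_ge0 ?exprn_ge0 ?(ltW a_gt0).
have leS f : size f = m -> S f <= kappa * m%:R ^+ 2 + a * m%:R ^+ 2 * trans f.
  move=> szf; have [le_S|lt_S] := lerP (S f) (kappa * m%:R ^+ 2).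
    by rewrite (le_trans le_S)// lerDl mulr_ge0.
  (* The sampled digraph lives on positions: a vertex drawn twice gives two positions without an arc
     between them. *)
  pose e' (i j : 'I_m) := e (nth x0 f i) (nth x0 f j).
  have e'_irr : irreflexive e' by move=> i; exact: e_irr.
  have [|s szs es] := transitive_of_weight e' e'_irr a r a_ge r_gt0.
    by rewrite card_ord exchange_big.
  have ge1 : 1 <= trans f.
    rewrite /trans (bigD1 (Tuple (introT eqP szs)))//= (pairwise_irr_uniq e')//.
    rewrite -map_comp pairwise_map es mulr1 lerDl.
    by apply: sumr_ge0 => g _; rewrite mulr_ge0 ?ler0n.
  have leSa : S f <= a * m%:R ^+ 2.
    rewrite expr2 mulrA mulr_natr -mulr_natl.
    have -> : m%:R * (a * m%:R) = \sum_(i < m) \sum_(j < m) a.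
      by rewrite !sumr_const !card_ord mulr_natr mulr_natl.
    by apply: ler_sum => i _; apply: ler_sum => j _; apply: weight_le; lra.
  apply: (le_trans leSa); rewrite -[leLHS]add0r; apply: lerD.
    by rewrite mulr_ge0 ?exprn_ge0.
  by rewrite ler_peMr.
have avg_trans : avg m trans <= m%:R ^+ r.+1 * p.
  rewrite avg_sum -natrX -[in leRHS](card_ord m) -card_tuple mulr_natl -sumr_const.
  apply: ler_sum => g _; rewrite avgZ; have [ug|_] := boolP (uniq g); last first.
    by rewrite mul0r -(avg_cst (T := T) T_gt0 r.+1 0) ler_avg.
  rewrite mul1r (avg_proj x0 m (map val g) (fun s => (pairwise e s)%:R))//.
  - by rewrite size_map size_tuple.
  - by rewrite map_inj_uniq//; exact: val_inj.
  - by apply/allP => _ /mapP[i _ ->]; rewrite /= ltn_ord.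
have main : m%:R * (m%:R - 1) * W <= kappa * m%:R ^+ 2 + a * m%:R ^+ 2 * (m%:R ^+ r.+1 * p).
  rewrite -avgS; apply: le_trans (ler_avg _ _ _ leS) _.
  by rewrite avgD avg_cst// avgZ lerD2l ler_pM2l// mulr_gt0// exprn_gt0.
have m_ge1 : 1 <= m%:R :> R by rewrite ler1n.
have mM_gt0 : 0 < m%:R ^+ r.+1 :> R by rewrite exprn_gt0.
rewrite ler_pdivrMr; last by rewrite !mulr_gt0.
have -> : p * (2 * a * m%:R ^+ r.+1) = 2 * a * (m%:R ^+ r.+1 * p) by ring.
move: main; set q := _ * p => main.
have {}main : (m%:R - 1) * W <= m%:R * (kappa + a * q).
  rewrite -(ler_pM2l m_gt0) mulrA (le_trans main)//; lra.
have : (m%:R - 1) * (kappa + gamma) <= m%:R * (kappa + a * q).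
  by apply: le_trans main; rewrite ler_wpM2l// subr_ge0.
move=> {}main; suff : m%:R * (gamma / 2) <= m%:R * (a * q).
  by rewrite ler_pM2l//; lra.
lra.
Qed.

(** * The theorem of Erdos on complete k-partite k-uniform hypergraphs *)

(** The tangent line at [c], which gives Jensen's inequality for t-th powers. In the induction,
    multiplying by [y] leaves the error b (y - c)^2 >= 0. *)
Lemma tangent_exp {R : realFieldType} (c : R) (t : nat) : 0 < c ->
  exists2 b : R, 0 <= b & forall y, 0 <= y -> c ^+ t + b * (y - c) <= y ^+ t.
Proof.
move=> c_gt0; elim: t => [|t [b b_ge0 IH]].
  by exists 0 => // y _; rewrite mul0r addr0 !expr0.
exists (c ^+ t + b * c) => [|y y_ge0].
  by rewrite addr_ge0 ?mulr_ge0 ?exprn_ge0 ?(ltW c_gt0).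
have := ler_wpM2l y_ge0 (IH y y_ge0); rewrite !exprS; apply: le_trans.
rewrite -subr_ge0.
have -> : y * (c ^+ t + b * (y - c)) - (c * c ^+ t + (c ^+ t + b * c) * (y - c))
   = b * (y - c) ^+ 2 by ring.
by rewrite mulr_ge0 ?sqr_ge0.
Qed.

(** Induction on [k]: by Jensen, the common link of [t] random vertices has expected density at
    least c^t, so some [t] distinct vertices have a common link of density at least c^t / 2, to
    which the induction hypothesis applies. *)
Lemma erdos_kpartite {R : realType} (t k : nat) (c : R) : 0 < c ->
  exists n0 : nat, forall (T : finType), (n0 <= #|T|)%N ->
    forall P : pred (seq T), c <= avg k (fun s => (P s)%:R) ->
    exists L : seq (seq T),
      [/\ size L = k, all (fun A => uniq A && (size A == t)) L &
          forall s, all2 (fun x (A : seq T) => x \in A) s L -> P s].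
Proof.
elim: k c => [|k IH] c c_gt0.
  exists 0%N => T _ P /= le_c; exists [::]; split => // -[] // _.
  by move: le_c; case: (P [::]) => //; rewrite leNgt c_gt0.
have ct_gt0 : 0 < c ^+ t by rewrite exprn_gt0.
have [n1 {}IH] := IH (c ^+ t / 2) (divr_gt0 ct_gt0 (ltr0Sn _ _)).
(* The second bound makes repeated draws cost at most c^t / 2; its successor keeps [T] nonempty. *)
exists (maxn n1 (Num.trunc ((t ^ 2)%:R / (c ^+ t / 2))).+1) => T.
rewrite geq_max => /andP[le_n1 T_large] P le_c.
have T_gt0 : (0 < #|T|)%N by apply: leq_trans T_large.
have T_gt0' : 0 < #|T|%:R :> R by rewrite ltr0n.
have small : (t ^ 2)%:R / #|T|%:R <= c ^+ t / 2.
  rewrite ler_pdivrMr// mulrC -ler_pdivrMr ?divr_gt0//.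
  by apply: le_trans (ltW (truncnS_gt _)) _; rewrite ler_nat.
pose dens s : R := avg 1 (fun x => (all (fun y => P (y :: s)) x)%:R).
have dens_ge0 s : 0 <= dens s.
  by rewrite -(avg_cst (T := T) T_gt0 1 0) ler_avg// => x _; rewrite ler0n.
have avg_dens : c <= avg k dens.
  apply: le_trans le_c _; rewrite /dens avg_exchange /=.
  rewrite ler_pM2r ?invr_gt0//; apply: ler_sum => x _.
  by apply: ler_avg => s _; rewrite andbT.
have [b b_ge0 le_b] := tangent_exp c t c_gt0.
have jensen : c ^+ t <= avg k (fun s => dens s ^+ t).
  have := ler_avg k _ _ (fun s _ => le_b _ (dens_ge0 s)); apply: le_trans.
  by rewrite avgD avg_cst// avgZ avgD avg_cst// lerDl mulr_ge0// subr_ge0.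
pose link (u : seq T) s := all (fun y => P (y :: s)) u.
(* The penalty lets one choice of [u] meet both demands: a sequence with a repetition scores at most
   0. *)
have [u szu le_u] := avg_exists T_gt0 t
  (fun u => avg k (fun s => (link u s)%:R) + -1 * (~~ uniq u)%:R : R).
have {}le_u : c ^+ t / 2 <= avg k (fun s => (link u s)%:R) - (~~ uniq u)%:R.
  rewrite -mulN1r; apply: le_trans le_u; rewrite avgD avgZ mulN1r avg_exchange.
  rewrite (eq_avg _ _ (fun s => dens s ^+ t)) => [|s _]; last by rewrite avg_all.
  have := @avg_nuniq_le R T T_gt0 t; lra.
have uniq_u : uniq u.
  case: (boolP (uniq u)) le_u => // _; rewrite leNgt => /negP[].
  apply: (@le_lt_trans _ _ 0); last by rewrite divr_gt0.
  rewrite subr_le0 /= -[leRHS](avg_cst (T := T) T_gt0 k); apply: ler_avg => s _.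
  by rewrite ler_nat leq_b1.
move: le_u; rewrite uniq_u subr0 => /(IH _ le_n1)[L [szL L_ok L_P]].
exists (u :: L); split; rewrite /= ?szL ?uniq_u ?szu ?eqxx//.
by move=> [|x s] //= /andP[xu /L_P /allP]; apply.
Qed.

(** * Arc weights, Turan numbers and the blow-up *)

Lemma weight_sum_e_a (R : realType) (a : R) (n : nat) (adj : rel 'I_n) :
  loopless adj -> \sum_u \sum_v weight adj a u v = 2 * e_a a adj.
Proof.
move=> ll; rewrite pair_bigA /=.
pose w (p : 'I_n * 'I_n) := weight adj a p.1 p.2.
have split_w : \sum_p w p =
    \sum_(p : 'I_n * 'I_n | (p.1 < p.2)%N) w p + \sum_(p : 'I_n * 'I_n | (p.2 < p.1)%N) w p.
  rewrite (bigID (fun p : 'I_n * 'I_n => (p.1 < p.2)%N)) /=; congr (_ + _).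
  rewrite (bigID (fun p : 'I_n * 'I_n => (p.2 < p.1)%N)) /= [X in _ + X]big1 ?addr0.
    by apply: eq_bigl => p; case: ltngtP.
  move=> [u v] /= uv; have -> : u = v by apply/val_inj => /=; move: uv; case: ltngtP.
  by rewrite /w /weight /= (negbTE (ll v)) /= mulr0 !addr0.
have swapK : involutive (fun p : 'I_n * 'I_n => (p.2, p.1)) by case.
have swap : \sum_(p : 'I_n * 'I_n | (p.2 < p.1)%N) w p =
    \sum_(p : 'I_n * 'I_n | (p.1 < p.2)%N) w p.
  rewrite (reindex_inj (inv_inj swapK)) /=.
  apply: eq_bigr => -[u v] _; rewrite /w /weight /=.
  by rewrite [(adj v u)%:R + _]addrC [adj v u && _]andbC.
rewrite -/w split_w swap -mulr2n -[LHS]mulr_natl; congr (_ * _).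
rewrite /e_a /f1 /f2 -!sum1_card !natr_sum ![\sum_(_ in _) _]big_mkcond mulr_sumr.
rewrite -big_split big_mkcond.
apply: eq_bigr => -[u v] _; rewrite !inE /w /weight /=.
case: ltnP => _ /=; last by rewrite mulr0 addr0.
case: (adj u v); case: (adj v u) => /=; ring.
Qed.

(** The quotient by [r] is injective on a residue class, so at most n(n/r + 1) ordered pairs lie
    within classes; the extra 1 gives the linear error. *)
Lemma turan_ge (R : realType) (r n : nat) : (0 < r)%N ->
  n%:R ^+ 2 * (1 - r%:R^-1) - n%:R <= 2 * (turan r n)%:R :> R.
Proof.
move=> r_gt0.
pose same := [set p : 'I_n * 'I_n | (p.1 %% r == p.2 %% r)%N].
pose up := [set p : 'I_n * 'I_n | (p.1 < p.2)%N && (p.1 %% r != p.2 %% r)%N].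
pose down := [set p : 'I_n * 'I_n | (p.2 < p.1)%N && (p.1 %% r != p.2 %% r)%N].
have swapK : involutive (fun p : 'I_n * 'I_n => (p.2, p.1)) by case.
have card_down : #|down| = #|up|.
  rewrite -(card_imset _ (inv_inj swapK)); apply: eq_card => -[u v].
  rewrite inE; apply/imsetP/idP => [[[x y]]|uv].
    by rewrite inE /= => xy [-> ->]; rewrite [(y %% r)%N == _]eq_sym.
  by exists (v, u); rewrite // inE /= [(v %% r)%N == _]eq_sym.
have card_same : (#|same| <= n * (n %/ r).+1)%N.
  have -> : #|same| = (\sum_(u < n) \sum_(v < n) (u %% r == v %% r))%N.
    rewrite pair_bigA -sum1_card big_mkcond /=; apply: eq_bigr => p _.
    by rewrite inE; case: eqP.
  rewrite -[n in (n * _)%N]card_ord -sum_nat_const; apply: leq_sum => u _.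
  have -> : (\sum_(v < n) (u %% r == v %% r) = #|[set v : 'I_n | u %% r == v %% r]|)%N.
    by rewrite -sum1_card [RHS]big_mkcond /=; apply: eq_bigr => v _; rewrite inE; case: eqP.
  rewrite -[X in (_ <= X)%N]card_ord.
  have lt_q (v : 'I_n) : (v %/ r < (n %/ r).+1)%N by rewrite ltnS leq_div2r// ltnW.
  apply: (leq_card_in (fun v : 'I_n => Ordinal (lt_q v))) => x y.
  rewrite !inE /= => /eqP ux /eqP uy [] eq_q; apply: val_inj => /=.
  by rewrite (divn_eq x r) (divn_eq y r) eq_q -ux -uy.
have cover : (n * n <= #|up| + #|down| + #|same|)%N.
  rewrite -[n in (n * _)%N]card_ord -[n in (_ * n)%N]card_ord -card_prod -cardsT.
  apply: leq_trans (leq_add (leq_card_setU up down) (leqnn _)).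
  apply: leq_trans (leq_card_setU _ _).
  apply: subset_leq_card; apply/subsetP => -[u v] _; rewrite !inE /=.
  by case: eqP => //=; case: ltngtP => // /val_inj ->.
rewrite card_down in cover.
have r0 : 0 < r%:R :> R by rewrite ltr0n.
have le_q : (n %/ r)%:R <= n%:R / r%:R :> R.
  by rewrite ler_pdivlMr// -natrM ler_nat leq_trunc_div.
have : (n * n)%:R <= (#|up| + #|up| + n * (n %/ r).+1)%:R :> R.
  by rewrite ler_nat (leq_trans cover)// leq_add2l.
have n0 : 0 <= n%:R :> R by [].
have := ler_wpM2l n0 le_q.
rewrite /turan -/up !natrD !natrM -natr1 expr2; lra.
Qed.


Theorem theorem3p1 (R : realType) (r t : nat) (a gamma : R) :
  (1 <= r)%N -> (1 <= t)%N -> 3 / 2 < a -> a <= 2 -> 0 < gamma ->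
  exists n0 : nat, forall (n : nat), (n0 <= n)%N ->
    forall adj : rel 'I_n, loopless adj ->
      a * (turan r n)%:R + gamma * (n ^ 2)%:R <= e_a a adj ->
      contains_blowup r t adj.

Proof.
move=> r_gt0 t_gt0 a_gt a_le2 gamma_gt0.
have [c c_gt0 supersat] := supersaturation a gamma r (ltW a_gt) r_gt0 gamma_gt0.
have [n1 erdos] := erdos_kpartite t r.+1 c c_gt0.
(* This ensures a n <= gamma n^2: doubling the hypothesis yields 2 gamma n^2, half of which absorbs
   the linear error of [turan_ge]. *)
exists (maxn n1 (Num.trunc (a / gamma)).+1) => n.
rewrite geq_max => /andP[n1_le n_large] adj ll le_e.
have n_gt0 : (0 < n)%N by apply: leq_trans n_large.
have e_irr : irreflexive adj by move=> v; apply/negbTE/ll.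
pose v0 := Ordinal n_gt0.
have le_c : c <= avg r.+1 (fun s => (pairwise adj s)%:R).
  apply: supersat; rewrite ?card_ord// weight_sum_e_a//.
  have n_ge : a <= gamma * n%:R.
    rewrite mulrC -ler_pdivrMr//.
    by apply: le_trans (ltW (truncnS_gt _)) _; rewrite ler_nat.
  have n0 : 0 <= n%:R :> R by [].
  have := ler_wpM2r n0 n_ge; rewrite -mulrA -expr2.
  have a_gt0 : 0 < a by lra.
  have := ler_wpM2l (ltW a_gt0) (turan_ge R r n r_gt0).
  move: le_e; rewrite natrX; lra.
have [|L [szL L_ok L_P]] := erdos 'I_n _ _ le_c; first by rewrite card_ord.
have L_nth (i : 'I_r.+1) : uniq (nth [::] L i) /\ size (nth [::] L i) = t.
  have /andP[? /eqP ?] : uniq (nth [::] L i) && (size (nth [::] L i) == t).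
    by apply: (allP L_ok); rewrite mem_nth// szL.
  by [].
pose phi (p : 'I_r.+1 * 'I_t) : 'I_n := nth v0 (nth [::] L p.1) p.2.
have phi_in i x : phi (i, x) \in nth [::] L i.
  by rewrite mem_nth// (L_nth i).2.
have phi_adj (i j : 'I_r.+1) (x y : 'I_t) : (i < j)%N -> adj (phi (i, x)) (phi (j, y)).
  (* A transversal of all classes through the two given vertices; the other classes use index 0,
     available because [t] is positive. *)
  move=> ij; pose z k := if k == i then x else if k == j then y else Ordinal t_gt0.
  pose s := [seq phi (k, z k) | k <- enum 'I_r.+1].
  have szs : size s = r.+1 by rewrite size_map size_enum_ord.
  have s_nth (k : 'I_r.+1) : nth v0 s k = phi (k, z k).
    by rewrite (nth_map k) ?size_enum_ord// nth_ord_enum.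
  have: pairwise adj s.
    apply: L_P; rewrite all2E szs szL eqxx /=.
    apply/(all_nthP (v0, [::])) => k; rewrite size_zip szs szL minnn => kr.
    by rewrite nth_zip ?szs// /= (s_nth (Ordinal kr)) phi_in.
  move/(pairwiseP v0)/(_ i j); rewrite !inE szs !s_nth => /(_ (ltn_ord i) (ltn_ord j) ij).
  by rewrite /z eqxx (negbTE (_ : j != i)) ?eqxx// neq_ltn ij orbT.
(* Two classes are disjoint because a shared vertex would carry a loop. *)
exists phi; split => // -[i x] [j y] eq_phi.
have [ij|ji|/val_inj eq_ij] := ltngtP i j.
- by have := phi_adj i j x y ij; rewrite eq_phi e_irr.
- by have := phi_adj j i y x ji; rewrite eq_phi e_irr.
subst j; have [uL szLi] := L_nth i; congr (_, _); apply/val_inj/eqP.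
by move/eqP: eq_phi; rewrite /phi /= nth_uniq ?szLi.
Qed.
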